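(* Let $\ell>0$, $V>0$ and $\rho_-,\rho_+$ be given with $$0\le \rho_-\le \rho^*\le \rho_+\le 1,\qquad f(\rho_-)=f(\rho_+).$$ Then there exists a monotone stationary profile $W:\mathbb{R}\to[0,1]$ which satisfies the delay differential equation $$W'(x)=\frac{W^2(x)}{\ell\,\phi(W(x))}\left[\phi(W(x))-\phi\!\left(W\!\left(x+\frac{\ell}{W(x)}\right)\right)\right]$$ and the boundary values $$\lim_{x\to-\infty}W(x)=\rho_-,\qquad \lim_{x\to+\infty}W(x)=\rho_+.$$
   Context: Standing assumptions. $\ell>0$ is the car length and $V>0$ the speed limit. The function $\phi:[0,1]\to\mathbb{R}$ is twice continuously differentiable with $\phi(0)=1$, $\phi(1)=0$, and $\phi'(\rho)\le-\hat c_0<0$ for all $\rho\in[0,1]$, for some constant $\hat c_0>0$. The flux is $f(\rho)=V\rho\,\phi(\rho)$; it satisfies $f(0)=f(1)=0$, $f''(\rho)\le -c_0<0$ on $[0,1]$ for some constant $c_0>0$, and $\rho^*\in(0,1)$ is the unique point with $f'(\rho^* )=0$. Convention in the delay differential equation: if $W(x)=0$ for some $x$, then $W(x+\ell/W(x))$ is understood as $W(+\infty):=\lim_{y\to+\infty}W(y)$. In the degenerate case $\rho_-=0$, $\rho_+=1$, the profile is understood to be a step function equal to $0$ to the left and to $1$ to the right of some point $\hat x$. A stationary profile is a function $W$ satisfying this delay differential equation. *)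

(* Defs.v *)
From HB Require Import structures.
From mathcomp Require Import all_boot all_order all_algebra.
From mathcomp Require Import all_classical all_reals all_analysis.

Set Implicit Arguments.
Unset Strict Implicit.
Unset Printing Implicit Defensive.

Import Order.TTheory GRing.Theory Num.Theory.
Import numFieldNormedType.Exports.

Local Open Scope classical_set_scope.
Local Open Scope ring_scope.

(* A function on I is represented by a total function of which only the values
   on I matter.  The difference quotients are taken within I, so the derivative
   is one-sided at an endpoint of an interval I. *)
Definition has_derivative_on {R : realType} (I : set R) (g dg : R -> R) : Prop :=
  forall x, I x ->
    (g y - g x) / (y - x) @[y --> within I x^'] --> dg x.

Definition flux {R : realType} (V : R) (phi : R -> R) (rho : R) : R :=
  V * rho * phi rho.

(* The value W(x + ell / W(x)), read as W(+oo) when W(x) = 0. *)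
Definition W_ahead {R : realType} (ell : R) (W : R -> R) (x : R) : R :=
  if W x == 0 then lim (W y @[y --> +oo]) else W (x + ell / W x).

(* Division by 0 is total here: the condition phi (W x) != 0 says that the
   right-hand side of the equation is meaningful at x. *)
Definition satisfies_dde_at {R : realType} (ell : R) (phi W : R -> R) (x : R)
    : Prop :=
  phi (W x) != 0 /\
  is_derive x 1 W
    (W x ^+ 2 / (ell * phi (W x)) * (phi (W x) - phi (W_ahead ell W x))).

(* In the degenerate case the profile is a step function, with an arbitrary
   value at the jump.  The right-hand side of the equation then reads 0/0 to the
   right of the jump, so the equation is required on its left only. *)
Definition stationary_profile {R : realType} (ell : R) (phi : R -> R)
    (rhom rhop : R) (W : R -> R) : Prop :=
  if (rhom == 0) && (rhop == 1) then
    exists xhat : R,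
      [/\ forall x, x < xhat -> W x = 0,
          forall x, xhat < x -> W x = 1 &
          forall x, x < xhat -> satisfies_dde_at ell phi W x]
  else forall x, satisfies_dde_at ell phi W x.

(* Main.v *)
Require Import Defs.
From HB Require Import structures.
From mathcomp Require Import all_boot all_order all_algebra.
From mathcomp Require Import all_classical all_reals all_analysis.
From mathcomp Require Import measurable_realfun ring lra.
Import Order.TTheory GRing.Theory Num.Theory.
Import numFieldNormedType.Exports.
Local Open Scope classical_set_scope.
Local Open Scope ring_scope.

(** The state-dependent delay disappears when the equation is written in the
    time of a single car.  Let z(t) be the position of a car moving through the
    profile and h(t) = 1 / W(z(t)) its headway in units of ell.  The car drives
    at a speed proportional to phi (1/h), and its leader, at z + ell h, follows
    the same trajectory with a constant time shift, here normalised to 1.  So,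
    with G(y) = c phi(1/y),

      z' = ell G(h),   z(t + 1) - z(t) = ell h(t),

    that is, h is a fixed point of the averaging operator

      (T k)(t) = int_t^(t+1) G(k(s)) ds.

    Choosing c so that G fixes a = 1/rhop makes it fix b = 1/rhom as well,
    because the two fluxes agree.  The map y |-> phi(1/y) = y f(1/y) / V is the
    perspective of the concave flux, hence concave: G is increasing on [a, b],
    lies above the diagonal strictly between a and b, and lies between its
    tangent at a, of slope g > 1, and a parabola with the same tangent
    ([monostable], [fundamental_diagram_monostable]).

    This is a monostable travelling wave problem, solved with exponential
    barriers.  Take lam > 0 with g (1 - exp(-lam)) = lam ([decay_rate]), so that
    w(t) = exp(-lam t) solves the equation linearised at a.  Then min(b, a + w)
    is a supersolution of T by the tangent bound, and a + w - M w^2 a subsolution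
    by the parabola bound.  The operator T is monotone, and the infimum of all
    nonincreasing supersolutions above the subsolution is a fixed point, as in
    the theorem of Knaster and Tarski ([exists_fixed_profile]): no limit is
    exchanged with an integral.  The barriers give h -> a at +oo and exclude the
    constant a; at -oo the headway increases to a fixed point of G above a,
    which can only be b.

    Finally z is a bijection with positive derivative, and W = 1/h o z^-1 is the
    profile ([profile_of_headway]).  The states rhom = 0, rhop = 1 give a step
    and rhom = rhop = rhostar a constant. *)

Set Implicit Arguments.
Unset Strict Implicit.

(** * Integrals and primitives of monotone functions *)

Lemma is_derive_difference_quotient (R : realType) (f : R -> R) (x l : R) :
  (f y - f x) / (y - x) @[y --> x^'] --> l -> is_derive x 1 f l.
Proof.
move=> fl; apply/is_derive1_caratheodory.
exists (fun y => if y == x then l else (f y - f x) / (y - x)); split.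
- move=> y; case: eqVneq => [->|yx]; first by rewrite !subrr mulr0.
  by rewrite divfK // subr_eq0.
- apply/continuous_withinNx; rewrite eqxx.
  apply: cvg_trans fl; apply: near_eq_cvg; near=> y.
  rewrite ifN //; near: y; exact: nbhs_dnbhs_neq.
- by rewrite eqxx.
Unshelve. all: by end_near. Qed.

Definition segint {R : realType} (F : R -> R) (s t : R) : R :=
  \int[lebesgue_measure]_(x in `[s, t]) F x.

Lemma nonincreasing_integrable (R : realType) (F : R -> R) (s t : R) :
  nonincreasing_fun F ->
  (@lebesgue_measure R).-integrable `[s, t] (EFin \o F).
Proof.
move=> Fni; apply: measurable_bounded_integrable => //.
- exact/compact_finite_measure/segment_compact.
- exact: nonincreasing_measurable.
- exists (`|F s| + `|F t|); split; first exact: num_real.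
  move=> M lM x; rewrite /= in_itv /= => /andP[sx xt].
  apply: le_trans (ltW lM); rewrite ler_norml; apply/andP; split.
    have := Fni _ _ xt; have := ler_norm (- F t); rewrite normrN.
    by have := normr_ge0 (F s); lra.
  have := Fni _ _ sx; have := ler_norm (F s).
  by have := normr_ge0 (F t); lra.
Qed.

Lemma segint_cat (R : realType) (F : R -> R) (s u t : R) :
  nonincreasing_fun F -> s <= u -> u <= t ->
  segint F s t = segint F s u + segint F u t.
Proof.
move=> Fni su ut; rewrite /segint.
have int := nonincreasing_integrable s t Fni.
have := @Rintegral_itvB R F (BLeft s) (BRight t) u int.
rewrite !bnd_simp => /(_ su ut) e.
rewrite -(@Rintegral_itv_obnd_cbnd R u (BRight t)) -?e ?subrKC //.
by apply: integrableS int => //; apply: subset_itvr; rewrite bnd_simp.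
Qed.

Lemma segint_cst (R : realType) (c s t : R) : s <= t ->
  segint (fun=> c) s t = c * (t - s).
Proof.
move=> st; rewrite /segint Rintegral_cst //= lebesgue_measure_itv /= lte_fin.
move: st; rewrite le_eqVlt => /predU1P[->|->] //.
by rewrite ltxx subrr mulr0.
Qed.

Lemma segint_le (R : realType) (F1 F2 : R -> R) (s t : R) :
  nonincreasing_fun F1 -> nonincreasing_fun F2 ->
  (forall x, s <= x -> x <= t -> F1 x <= F2 x) ->
  segint F1 s t <= segint F2 s t.
Proof.
move=> n1 n2 le12; apply: le_Rintegral => //.
- exact: nonincreasing_integrable.
- exact: nonincreasing_integrable.
- by move=> x; rewrite /= in_itv /= => /andP[]; exact: le12.
Qed.

Lemma segint_bounds (R : realType) (F : R -> R) (s t : R) :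
  nonincreasing_fun F -> s <= t ->
  F t * (t - s) <= segint F s t <= F s * (t - s).
Proof.
move=> Fni st; rewrite -!segint_cst //.
apply/andP; split; apply: segint_le => // x sx xt; exact: Fni.
Qed.

Lemma segint_derivative (R : realType) (E P : R -> R) (s t : R) : s < t ->
  (forall x : R, is_derive x 1 P (E x)) -> continuous E ->
  segint E s t = P t - P s.
Proof.
move=> st dP cE; rewrite /segint /Rintegral (@continuous_FTC2 R E P s t) //.
- exact: continuous_subspaceT.
- have cP x : {for x, continuous P}.
    by apply: differentiable_continuous; apply/derivable1_diffP; case: (dP x).
  split => [x _| |]; first by case: (dP x).
  + by apply: cvg_at_right_filter; exact: cP.
  + by apply: cvg_at_left_filter; exact: cP.
- by move=> x _; rewrite derive1E; case: (dP x).
Qed.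

Lemma continuous_segment_integrable (R : realType) (E : R -> R) (s t : R) :
  continuous E -> (@lebesgue_measure R).-integrable `[s, t] (EFin \o E).
Proof.
move=> cE; apply: continuous_compact_integrable; first exact: segment_compact.
exact: continuous_subspaceT.
Qed.

(** The barriers are sums of exponentials, whose integrals are increments of an
    explicit primitive; this and the next lemma compare an integral of G o k
    with them. *)
Lemma segint_le_derivative (R : realType) (F E P : R -> R) (s t : R) :
  nonincreasing_fun F -> s < t ->
  (forall x : R, is_derive x 1 P (E x)) -> continuous E ->
  (forall x, F x <= E x) -> segint F s t <= P t - P s.
Proof.
move=> Fni st dP cE le.
rewrite -(segint_derivative st dP cE); apply: le_Rintegral => //.
- exact: nonincreasing_integrable.
- exact: continuous_segment_integrable.
Qed.

Lemma segint_ge_derivative (R : realType) (F E P : R -> R) (s t : R) :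
  nonincreasing_fun F -> s < t ->
  (forall x : R, is_derive x 1 P (E x)) -> continuous E ->
  (forall x, E x <= F x) -> P t - P s <= segint F s t.
Proof.
move=> Fni st dP cE le.
rewrite -(segint_derivative st dP cE); apply: le_Rintegral => //.
- exact: continuous_segment_integrable.
- exact: nonincreasing_integrable.
Qed.

(** At most one of the two integrals is nonzero, which makes this the signed
    integral from 0 to t for t of either sign. *)
Definition primitive {R : realType} (F : R -> R) (t : R) : R :=
  segint F 0 t - segint F t 0.

Lemma segint_empty (R : realType) (F : R -> R) (s t : R) : t <= s ->
  segint F s t = 0.
Proof.
rewrite le_eqVlt => /predU1P[->|ts]; rewrite /segint.
  by rewrite set_itv1 Rintegral_set1.
by rewrite set_itv_ge ?Rintegral_set0 // bnd_simp -ltNge.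
Qed.

Lemma primitiveB (R : realType) (F : R -> R) (s t : R) :
  nonincreasing_fun F -> s <= t ->
  primitive F t - primitive F s = segint F s t.
Proof.
move=> Fni st; rewrite /primitive.
have [s0|s0] := leP 0 s.
  have t0 := le_trans s0 st.
  rewrite (segint_empty F s0) (segint_empty F t0).
  by rewrite (segint_cat Fni s0 st); lra.
rewrite (segint_empty F (ltW s0)).
have [t0|t0] := leP 0 t.
  by rewrite (segint_empty F t0) (segint_cat Fni (ltW s0) t0); lra.
by rewrite (segint_empty F (ltW t0)) (segint_cat Fni st (ltW t0)); lra.
Qed.

Lemma primitive_bounds (R : realType) (F : R -> R) (s t : R) :
  nonincreasing_fun F -> s <= t ->
  F t * (t - s) <= primitive F t - primitive F s <= F s * (t - s).
Proof. by move=> Fni st; rewrite primitiveB //; exact: segint_bounds. Qed.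

(** The difference quotient lies between F t and F y by monotonicity, so that
    continuity at the single point t suffices. *)
Lemma is_derive_primitive (R : realType) (F : R -> R) (t : R) :
  nonincreasing_fun F -> {for t, continuous F} ->
  is_derive t 1 (primitive F) (F t).
Proof.
move=> Fni cF; apply: is_derive_difference_quotient.
apply/cvgrPdist_le => e e0.
have nF : \forall y \near t, `|F t - F y| <= e.
  by move/cvgrPdist_le : cF; exact.
rewrite near_withinE; apply: filterS nF => y.
set q := (primitive F y - primitive F t) / (y - t) => + yt.
rewrite !ler_distl => /andP[lo up].
have qE : primitive F y - primitive F t = q * (y - t).
  by rewrite /q divfK // subr_eq0.
move: yt; rewrite neq_lt => /orP[yt|ty].
  have /andP[] := primitive_bounds Fni (ltW yt).
  rewrite (_ : primitive F t - primitive F y = q * (t - y)); last by lra.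
  by rewrite !ler_pM2r ?subr_gt0 //; lra.
have /andP[] := primitive_bounds Fni (ltW ty).
by rewrite qE !ler_pM2r ?subr_gt0 //; lra.
Qed.

Lemma primitive_continuous (R : realType) (F : R -> R) (a b : R) :
  nonincreasing_fun F -> (forall t, a <= F t <= b) -> continuous (primitive F).
Proof.
move=> Fni Fab t; pose K := `|a| + `|b| + 1.
have K0 : 0 < K by have := normr_ge0 a; have := normr_ge0 b; rewrite /K; lra.
have FK s : - K <= F s <= K.
  have := Fab s; have := ler_norm (- a); have := ler_norm b; rewrite normrN /K.
  by have := normr_ge0 a; have := normr_ge0 b; lra.
have lip x y : x <= y -> `|primitive F y - primitive F x| <= K * (y - x).
  move=> xy; have yx0 : 0 <= y - x by lra.
  have /andP[lo up] := primitive_bounds Fni xy.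
  have /andP[lo' _] := FK y; have /andP[_ up'] := FK x.
  have := ler_wpM2r yx0 lo'; have := ler_wpM2r yx0 up'.
  by rewrite ler_norml; lra.
apply/cvgrPdist_le => e e0; near=> y.
have ty : `|t - y| < e / K.
  by near: y; apply/nbhs_ballP; exists (e / K) => //=; exact: divr_gt0.
rewrite ltr_pdivlMr // in ty.
have [le_ty|/ltW le_yt] := leP t y.
  rewrite distrC; apply: (le_trans (lip _ _ le_ty)).
  by move: ty; rewrite ler0_norm; lra.
apply: (le_trans (lip _ _ le_yt)).
by move: ty; rewrite ger0_norm; lra.
Unshelve. all: by end_near. Qed.

(** * The averaging operator and its exponential barriers *)

(** What the existence proof retains of y |-> c phi(1/y) on the interval of
    headways: a is an unstable fixed point of slope g > 1, b the only other one,
    and the graph lies between the tangent at a and a parabola. *)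
Record monostable {R : realType} (G : R -> R) (a b g C : R) : Prop :=
    Monostable {
  ms_lt : a < b;
  ms_slope : 1 < g;
  ms_curv : 0 <= C;
  ms_homo : forall x y, a <= x -> x <= y -> y <= b -> G x <= G y;
  ms_fix : G b = b;
  ms_above : forall x, a < x -> x < b -> x < G x;
  ms_cont : forall x, a <= x <= b -> {for x, continuous G};
  ms_tangent : forall x, a <= x <= b -> G x <= a + g * (x - a);
  ms_parabola : forall x, a <= x <= b ->
    a + g * (x - a) - C * (x - a) ^+ 2 <= G x }.

Definition headway_profile {R : realType} (a b : R) (k : R -> R) : Prop :=
  nonincreasing_fun k /\ forall t, a <= k t <= b.

Definition average {R : realType} (G k : R -> R) (t : R) : R :=
  segint (G \o k) t (t + 1).

(** The right-hand side minus the left one changes sign between g - 1 and g; at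
    g - 1 this is the inequality exp(x) >= 1 + x. *)
Lemma decay_rate (R : realType) (g : R) : 1 < g ->
  exists2 lam : R, 0 < lam & g * (1 - expR (- lam)) = lam.
Proof.
move=> g1; pose f x : R := g * (1 - expR (- x)) - x.
have cf : continuous f.
  move=> x; apply: cvgB; last exact: cvg_id.
  apply: cvgM; first exact: cvg_cst.
  apply: cvgB; first exact: cvg_cst.
  by apply: continuous_comp; [exact: opp_continuous | exact: continuous_expR].
have f1 : 0 <= f (g - 1).
  rewrite /f expRN.
  have e : g <= expR (g - 1) by have := expR_ge1Dx (g - 1); lra.
  have : (expR (g - 1))^-1 <= g^-1 by rewrite lef_pV2 // posrE; lra.
  move=> /(ler_wpM2l (_ : 0 <= g)); rewrite divff; last by lra.
  by move=> /(_ ltac:(lra)); lra.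
have f2 : f g <= 0.
  have g0 : 0 < g by lra.
  by have := mulr_gt0 g0 (expR_gt0 (- g)); rewrite /f; lra.
have [] := @IVT R f (g - 1) g 0; first by lra.
- exact: continuous_subspaceT.
- by rewrite ge_min le_max f1 f2 orbT.
move=> lam; rewrite in_itv /= => /andP[l1 l2] fl; exists lam; first by lra.
by move: fl; rewrite /f; lra.
Qed.

Lemma is_derive_expRM (R : realType) (c x : R) :
  is_derive x 1 (fun s : R => expR (c * s)) (c * expR (c * x)).
Proof.
have -> : (fun s : R => expR (c * s)) = expR \o (c *: (id : R -> R)) by [].
by apply: is_derive_eq; rewrite /= /GRing.scale /= mulr1 mulrC.
Qed.

Lemma ms_range (R : realType) (G : R -> R) (a b g C : R) (x : R) :
  monostable G a b g C -> a <= x <= b -> a <= G x <= b.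
Proof.
move=> ms /andP[ax xb]; have ab := ms_lt ms.
have aab : a <= a <= b by lra.
have ba : b <= b by lra.
have := ms_parabola ms aab; rewrite subrr expr0n /= !mulr0 addr0 subr0 => aG.
have aa : a <= a by lra.
have := ms_homo ms aa ax xb; have := ms_homo ms ax xb ba.
by rewrite (ms_fix ms); lra.
Qed.

Lemma profile_comp (R : realType) (G : R -> R) (a b g C : R) (k : R -> R) :
  monostable G a b g C -> headway_profile a b k -> nonincreasing_fun (G \o k).
Proof.
move=> ms [kni kab] s t st /=; apply: (ms_homo ms).
- by case/andP: (kab t).
- exact: kni.
- by case/andP: (kab s).
Qed.

Lemma average_bounds (R : realType) (G : R -> R) (a b g C : R) (k : R -> R)
    (t : R) :
  monostable G a b g C -> headway_profile a b k ->
  G (k (t + 1)) <= average G k t <= G (k t).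
Proof.
move=> ms pk; have t1 : t <= t + 1 by lra.
have := segint_bounds (profile_comp ms pk) t1.
by rewrite addrAC subrr add0r !mulr1.
Qed.

Lemma average_primitive (R : realType) (G : R -> R) (a b g C : R) (k : R -> R)
    (t : R) :
  monostable G a b g C -> headway_profile a b k ->
  average G k t = primitive (G \o k) (t + 1) - primitive (G \o k) t.
Proof.
by move=> ms pk; rewrite primitiveB //; [exact: profile_comp ms pk | lra].
Qed.

(** When the windows of s and t overlap, the average loses the integral over
    [t, s] and gains the one over [t + 1, s + 1], where the integrand is smaller;
    otherwise the two windows compare pointwise. *)
Lemma average_profile (R : realType) (G : R -> R) (a b g C : R) (k : R -> R) :
  monostable G a b g C -> headway_profile a b k ->
  headway_profile a b (average G k).
Proof.
move=> ms pk; have Fni := profile_comp ms pk; split.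
  move=> t s ts; have [st|st] := leP s (t + 1); last first.
    have /andP[_ h1] := average_bounds s ms pk.
    have /andP[h2 _] := average_bounds t ms pk.
    by apply: le_trans h1 (le_trans _ h2); apply: Fni; lra.
  rewrite !(average_primitive _ ms pk).
  have ts1 : t + 1 <= s + 1 by lra.
  have /andP[_] := primitive_bounds Fni ts1.
  have /andP[+ _] := primitive_bounds Fni ts.
  have e : s + 1 - (t + 1) = s - t by lra.
  have := ler_wpM2r (_ : 0 <= s - t) (Fni _ _ st); rewrite e.
  by move=> /(_ ltac:(lra)); lra.
move=> t; have /andP[h1 h2] := average_bounds t ms pk.
have /andP[h3 _] := ms_range ms (proj2 pk (t + 1)).
have /andP[_ h4] := ms_range ms (proj2 pk t).
by lra.
Qed.

Lemma average_le (R : realType) (G : R -> R) (a b g C : R) (k1 k2 : R -> R) :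
  monostable G a b g C -> headway_profile a b k1 -> headway_profile a b k2 ->
  (forall t, k1 t <= k2 t) -> forall t, average G k1 t <= average G k2 t.
Proof.
move=> ms p1 p2 le12 t.
apply: segint_le; [exact: profile_comp ms p1|exact: profile_comp ms p2|].
move=> x _ _; apply: (ms_homo ms) => //.
- by case/andP: (proj2 p1 x).
- by case/andP: (proj2 p2 x).
Qed.

Definition decay {R : realType} (lam t : R) : R := expR (- lam * t).

Lemma decay_gt0 (R : realType) (lam t : R) : 0 < decay lam t.
Proof. exact: expR_gt0. Qed.

Lemma decay_shift (R : realType) (lam t : R) :
  decay lam (t + 1) = expR (- lam) * decay lam t.
Proof. by rewrite /decay mulrDr mulr1 expRD mulrC. Qed.

Lemma decay_ni (R : realType) (lam : R) :
  0 < lam -> nonincreasing_fun (decay lam).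
Proof.
by move=> lam0 s t st; rewrite /decay ler_expR !mulNr lerN2 ler_pM2l.
Qed.

Lemma decay_sqr (R : realType) (lam t : R) :
  decay lam t ^+ 2 = decay (2 * lam) t.
Proof. by rewrite /decay -expRM_natl; congr expR; rewrite -mulr_natl; ring. Qed.

(** The common form of the integrands to which both barriers lead. *)
Definition decayquad {R : realType} (a lam p q s : R) : R :=
  a + p * decay lam s - q * decay lam s ^+ 2.

Lemma decayquad_continuous (R : realType) (a lam p q : R) :
  continuous (decayquad a lam p q).
Proof.
have cw : continuous (decay lam).
  move=> x; apply: differentiable_continuous; apply/derivable1_diffP.
  by case: (is_derive_expRM (- lam) x).
move=> x; apply: cvgB; first apply: cvgD; first exact: cvg_cst.
  by apply: cvgM; [exact: cvg_cst | exact: cw].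
by apply: cvgM; [exact: cvg_cst | apply: cvgM; exact: cw].
Qed.

Definition decayquad_primitive {R : realType} (a lam p q s : R) : R :=
  a * s - p / lam * decay lam s + q / (2 * lam) * decay lam s ^+ 2.

Lemma is_derive_decayquad_primitive (R : realType) (a lam p q x : R) :
  0 < lam ->
  is_derive x 1 (decayquad_primitive a lam p q) (decayquad a lam p q x).
Proof.
move=> lam0.
have -> : decayquad_primitive a lam p q = a *: (id : R -> R)
    - (p / lam) *: (fun s : R => expR (- lam * s))
    + (q / (2 * lam)) *: (fun s : R => expR (- (2 * lam) * s)).
  by apply/funext => s; rewrite /decayquad_primitive decay_sqr.
have d1 := is_derive_expRM (- lam) x.
have d2 := is_derive_expRM (- (2 * lam)) x.
have d := is_deriveD (is_deriveB (is_deriveZ a (is_derive_id x 1))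
  (is_deriveZ (p / lam) d1)) (is_deriveZ (q / (2 * lam)) d2).
apply: (is_derive_eq d); rewrite /decayquad decay_sqr /decay /GRing.scale /=.
set u := expR _; set v := expR _.
by field; rewrite lt0r_neq0.
Qed.

(** Averaging multiplies the linear term by 1/g, so that p = g reproduces it: this
    is the choice of lam.  It multiplies the quadratic term by
    (1 + exp(-lam)) / (2 g), which is smaller than 1/g; the gap is what lets the
    quadratic correction of the subsolution absorb the parabola error. *)
Lemma decayquad_primitive_increment (R : realType) (a g lam p q t : R) :
  1 < g -> 0 < lam -> g * (1 - expR (- lam)) = lam ->
  decayquad_primitive a lam p q (t + 1) - decayquad_primitive a lam p q t =
  a + p / g * decay lam t
    - q * (1 + expR (- lam)) / (2 * g) * decay lam t ^+ 2.
Proof.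
move=> g1 lam0 lamE.
have q1 : 1 - expR (- lam) = lam / g by rewrite -[X in X / g]lamE; field; lra.
rewrite /decayquad_primitive decay_shift.
have q2 : expR (- lam) = 1 - lam / g by lra.
have gn0 : g != 0 by rewrite lt0r_neq0 //; lra.
have ln0 : lam != 0 by rewrite lt0r_neq0.
by rewrite q2; field; rewrite gn0 ln0.
Qed.

Definition supersolution {R : realType} (a b lam t : R) : R :=
  Num.min b (a + decay lam t).

Lemma supersolution_profile (R : realType) (a b lam : R) :
  a < b -> 0 < lam -> headway_profile a b (supersolution a b lam).
Proof.
move=> ab lam0; split=> [s t st|t]; rewrite /supersolution.
  by rewrite le_min !ge_min lexx /= lerD2l decay_ni ?orbT.
by rewrite le_min ge_min lexx /= ltW //= lerDl ltW ?decay_gt0.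
Qed.

Lemma average_supersolution (R : realType) (G : R -> R) (a b g C lam : R) :
  monostable G a b g C -> 0 < lam -> g * (1 - expR (- lam)) = lam ->
  forall t, average G (supersolution a b lam) t <= supersolution a b lam t.
Proof.
move=> ms lam0 lamE t; have pk := supersolution_profile (ms_lt ms) lam0.
rewrite {2}/supersolution le_min; apply/andP; split.
  by case/andP: (proj2 (average_profile ms pk) t).
have t1 : t < t + 1 by lra.
apply: (le_trans (segint_le_derivative (profile_comp ms pk) t1
  (fun x => is_derive_decayquad_primitive a g 0 x lam0)
  (@decayquad_continuous R a lam g 0) _)); last first.
  rewrite (decayquad_primitive_increment _ _ _ _ (ms_slope ms) lam0 lamE).
  by rewrite divff; [lra | have := ms_slope ms; lra].
move=> x; rewrite /decayquad mul0r subr0 /=.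
apply: (le_trans (ms_tangent ms (proj2 pk x))).
rewrite lerD2l ler_pM2l; last by have := ms_slope ms; lra.
by rewrite lerBlDl /supersolution ge_min lexx orbT.
Qed.

(** The coefficient of the quadratic correction: the first term absorbs the
    curvature C of the parabola, the second keeps a + w - M w^2 below b. *)
Definition subdepth {R : realType} (a b C lam : R) : R :=
  2 * C / lam + (b - a)^-1.

Lemma subdepth_gt0 (R : realType) (a b C lam : R) :
  a < b -> 0 <= C -> 0 < lam -> 0 < subdepth a b C lam.
Proof.
move=> ab C0 lam0; rewrite /subdepth ltr_wpDl //.
  by rewrite divr_ge0 ?mulr_ge0 // ltW.
by rewrite invr_gt0 subr_gt0.
Qed.

Definition subsolution {R : realType} (a b C lam t : R) : R :=
  decayquad a lam 1 (subdepth a b C lam) t.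

(** Stated for every profile above the subsolution, because the subsolution is
    itself neither monotone nor above a. *)
Lemma average_subsolution (R : realType) (G : R -> R) (a b g C lam : R)
    (k : R -> R) :
  monostable G a b g C -> 0 < lam -> g * (1 - expR (- lam)) = lam ->
  headway_profile a b k -> (forall t, subsolution a b C lam t <= k t) ->
  forall t, subsolution a b C lam t <= average G k t.
Proof.
move=> ms lam0 lamE pk lek t; have g1 := ms_slope ms; have C0 := ms_curv ms.
have M0 := subdepth_gt0 (ms_lt ms) C0 lam0.
set M := subdepth a b C lam in M0 *.
have t1 : t < t + 1 by lra.
apply: (le_trans _ (segint_ge_derivative (profile_comp ms pk) t1
  (fun x => is_derive_decayquad_primitive a g (g * M + C) x lam0)
  (@decayquad_continuous R a lam g (g * M + C)) _)).
  rewrite (decayquad_primitive_increment _ _ _ _ (ms_slope ms) lam0 lamE).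
  rewrite divff ?mul1r /subsolution /decayquad; last by lra.
  rewrite mul1r lerD2l lerN2 ler_wpM2r ?sqr_ge0 // ler_pdivrMr; last by lra.
  have le1 : expR (- lam) <= 1 by rewrite -expR0 ler_expR oppr_le0 ltW.
  have e : g * expR (- lam) = g - lam by lra.
  have CM : 2 * C <= M * lam.
    rewrite /M /subdepth [leRHS]mulrDl divfK; last by lra.
    by rewrite lerDl mulr_ge0 ?invr_ge0 //; have := ms_lt ms; lra.
  have : C * expR (- lam) <= C * 1 by rewrite ler_wpM2l.
  have : g * M * expR (- lam) = (g - lam) * M by rewrite -e; ring.
  by rewrite -/M; lra.
move=> x; rewrite /decayquad /=; have := lek x.
rewrite /subsolution /decayquad -/M mul1r.
have /andP[ax xb] := proj2 pk x.
have wx0 := decay_gt0 lam x.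
have w2_ge0 : 0 <= decay lam x ^+ 2 by exact: sqr_ge0.
set v := decay lam x - M * decay lam x ^+ 2 => vk.
have Cw : 0 <= C * decay lam x ^+ 2 by exact: mulr_ge0.
(* Where v <= 0 the bound holds since G maps [a, b] into itself; elsewhere
   a + v is in [a, k x] and the parabola bound applies to it. *)
have [v0|v0] := leP v 0.
  have /andP[aG _] := ms_range ms (proj2 pk x).
  have : g * v <= 0 by nra.
  by rewrite /v; lra.
have avb : a <= a + v <= b by rewrite /v in vk v0 *; lra.
have := ms_parabola ms avb; rewrite (_ : a + v - a = v); last by lra.
have av : a <= a + v by lra.
have avk : a + v <= k x by rewrite /v in vk *; lra.
have := ms_homo ms av avk xb.
have Mw : 0 <= M * decay lam x ^+ 2 by rewrite mulr_ge0 // ltW.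
have vw : v <= decay lam x by rewrite /v; lra.
have vw2 : v ^+ 2 <= decay lam x ^+ 2 by rewrite ler_sqr // nnegrE; lra.
have : C * v ^+ 2 <= C * decay lam x ^+ 2 by rewrite ler_wpM2l.
by rewrite /v; lra.
Qed.

Lemma subsolution_le_supersolution (R : realType) (a b C lam t : R) :
  a < b -> 0 <= C -> 0 < lam ->
  subsolution a b C lam t <= supersolution a b lam t.
Proof.
move=> ab C0 lam0.
rewrite /subsolution /supersolution /decayquad mul1r le_min.
have wx0 := decay_gt0 lam t.
have w2_ge0 : 0 <= decay lam t ^+ 2 by exact: sqr_ge0.
have m0 : 0 <= 2 * C / lam.
  by rewrite divr_ge0 ?mulr_ge0 // ltW.
apply/andP; split; last first.
  by rewrite lerBlDr lerDl mulr_ge0 // ltW // subdepth_gt0.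
rewrite /subdepth mulrDl.
have mw : 0 <= 2 * C / lam * decay lam t ^+ 2 by exact: mulr_ge0.
suff : decay lam t <= (b - a) + (b - a)^-1 * decay lam t ^+ 2 by lra.
rewrite -(ler_pM2l (_ : 0 < b - a)) ?subr_gt0 // mulrDr mulVKf; last by lra.
have dw : 0 <= (b - a) * decay lam t by rewrite mulr_ge0 //; lra.
by have := sqr_ge0 (b - a - decay lam t); lra.
Qed.

(** * The headway of a car as a function of time *)

(** Knaster-Tarski: h is the infimum of the set S of profiles k with T k <= k
    above the subsolution.  Then T h <= T k <= k for k in S gives T h <= h, which
    puts T h in S and so gives h <= T h. *)
Lemma exists_fixed_profile (R : realType) (G : R -> R) (a b g C lam : R) :
  monostable G a b g C -> 0 < lam -> g * (1 - expR (- lam)) = lam ->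
  exists h : R -> R, [/\ headway_profile a b h,
    forall t, average G h t = h t,
    forall t, subsolution a b C lam t <= h t &
    forall t, h t <= supersolution a b lam t].
Proof.
move=> ms lam0 lamE; have ab := ms_lt ms; have C0 := ms_curv ms.
pose S := [set k : R -> R | [/\ headway_profile a b k,
  forall t, average G k t <= k t & forall t, subsolution a b C lam t <= k t]].
have Ssuper : S (supersolution a b lam).
  split; first exact: supersolution_profile.
  - exact: average_supersolution ms lam0 lamE.
  - by move=> t; exact: subsolution_le_supersolution.
pose h t := inf [set k t | k in S].
have inh t : has_inf [set k t | k in S].
  split; first by exists (supersolution a b lam t), (supersolution a b lam).
  by exists a => _ [k [[_ kab] _ _] <-]; case/andP: (kab t).
have hle k t : S k -> h t <= k t.
  by move=> Sk; apply: ge_inf; [case: (inh t) | exists k].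
have leh x t : (forall k, S k -> x <= k t) -> x <= h t.
  move=> xk; apply: lb_le_inf; first by case: (inh t).
  by move=> _ [k Sk <-]; exact: xk.
have ph : headway_profile a b h.
  split=> [s t st|t].
    apply: leh => k Sk; apply: (le_trans (hle k _ Sk)).
    by case: Sk => -[kni _] _ _; exact: kni.
  apply/andP; split.
    by apply: leh => k [[_ kab] _ _]; case/andP: (kab t).
  apply: (le_trans (hle _ t Ssuper)).
  by case: Ssuper => -[_ +] _ _ => /(_ t) /andP[].
have hsub t : subsolution a b C lam t <= h t by apply: leh => k [_ _].
have Th t : average G h t <= h t.
  apply: leh => k Sk; have [pk Tk _] := Sk.
  by apply: le_trans (Tk t); apply: (average_le ms ph pk) => s; exact: hle.
have STh : S (average G h).
  split; first exact: (average_profile ms ph).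
  - exact: (average_le ms (average_profile ms ph) ph Th).
  - exact: (average_subsolution ms lam0 lamE ph hsub).
exists h; split => // t; last exact: hle.
by apply/eqP; rewrite eq_le Th hle.
Qed.

(** The fixed point equation writes h as a difference of values of a primitive,
    which is Lipschitz; the infimum of profiles has no regularity of its own. *)
Lemma fixed_profile_continuous (R : realType) (G : R -> R) (a b g C : R)
    (h : R -> R) :
  monostable G a b g C -> headway_profile a b h ->
  (forall t, average G h t = h t) ->
  continuous h.
Proof.
move=> ms ph hE.
have cZ : continuous (primitive (G \o h)).
  apply: (@primitive_continuous R (G \o h) a b); first exact: profile_comp ms ph.
  by move=> t; exact: (ms_range ms (proj2 ph t)).
have -> : h = (fun t => primitive (G \o h) (t + 1) - primitive (G \o h) t).
  by apply/funext => t; rewrite -{1}hE (average_primitive _ ms ph).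
move=> t; apply: cvgB; last exact: cZ.
apply: (@continuous_comp _ _ _ (fun t : R => t + 1) (primitive (G \o h))).
  by apply: cvgD; [exact: cvg_id | exact: cvg_cst].
exact: cZ.
Qed.

Lemma fixed_profile_speed_continuous (R : realType) (G : R -> R) (a b g C : R)
    (h : R -> R) :
  monostable G a b g C -> headway_profile a b h ->
  (forall t, average G h t = h t) ->
  continuous (G \o h).
Proof.
move=> ms ph hE t; apply: continuous_comp.
  exact: (fixed_profile_continuous ms ph hE).
exact: (ms_cont ms (proj2 ph t)).
Qed.

Lemma is_derive_fixed_profile (R : realType) (G : R -> R) (a b g C : R)
    (h : R -> R) (t : R) :
  monostable G a b g C -> headway_profile a b h ->
  (forall t, average G h t = h t) ->
  is_derive t 1 h (G (h (t + 1)) - G (h t)).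
Proof.
move=> ms ph hE.
have cF := fixed_profile_speed_continuous ms ph hE.
have Fni := profile_comp ms ph.
have e : h = (primitive (G \o h) \o shift 1) - primitive (G \o h).
  by apply/funext => s; rewrite -{1}hE (average_primitive _ ms ph).
have d1 := is_derive_primitive Fni (cF (t + 1)).
have d2 := is_derive_primitive Fni (cF t).
suff : is_derive t 1 ((primitive (G \o h) \o shift 1) - primitive (G \o h))
    (G (h (t + 1)) - G (h t)) by rewrite -e.
apply: is_deriveB; rewrite -[G _]mulr1.
by apply: is_derive1_comp; exact: is_derive_shift.
Qed.

Lemma fixed_profile_cvg_pinfty (R : realType) (a b lam : R) (h : R -> R) :
  0 < lam -> headway_profile a b h ->
  (forall t, h t <= supersolution a b lam t) ->
  h t @[t --> +oo] --> a.
Proof.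
move=> lam0 ph hsup; apply/cvgrPdist_le => e e0; near=> t.
have /andP[ah _] := proj2 ph t.
have := hsup t; rewrite /supersolution le_min => /andP[_ hw].
have : decay lam t <= e.
  rewrite /decay -(lnK (_ : e \in Num.pos)) ?posrE // ler_expR.
  have : - ln e / lam <= t by near: t; apply: nbhs_pinfty_ge; exact: num_real.
  by rewrite ler_pdivrMr //; lra.
by rewrite ler0_norm; lra.
Unshelve. all: by end_near. Qed.

(** The quadratic w - M w^2 is largest where w = 1 / (2 M). *)
Lemma subsolution_gt (R : realType) (a b C lam : R) :
  a < b -> 0 <= C -> 0 < lam -> exists t : R, a < subsolution a b C lam t.
Proof.
move=> ab C0 lam0; have M0 := subdepth_gt0 ab C0 lam0.
rewrite /subsolution /decayquad; set M := subdepth _ _ _ _ in M0 *.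
exists (ln (2 * M) / lam).
have -> : decay lam (ln (2 * M) / lam) = (2 * M)^-1.
  rewrite /decay mulNr mulrC divfK ?lt0r_neq0 // expRN lnK // posrE.
  by rewrite mulr_gt0.
have -> : a + 1 * (2 * M)^-1 - M * (2 * M)^-1 ^+ 2 = a + (4 * M)^-1.
  by field; rewrite lt0r_neq0.
by rewrite ltrDl invr_gt0 mulr_gt0.
Qed.

(** Let L be the supremum of h.  Since G (h (t + 1)) <= h t <= L, letting t
    decrease gives G L <= L by continuity; as L > a, this is possible only at
    L = b. *)
Lemma fixed_profile_cvg_ninfty (R : realType) (G : R -> R) (a b g C : R)
    (h : R -> R) :
  monostable G a b g C -> headway_profile a b h ->
  (forall t, average G h t = h t) ->
  (exists t, a < h t) -> h t @[t --> -oo] --> b.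
Proof.
move=> ms ph hE [t0 at0]; have ab := ms_lt ms.
have sh : has_sup (range h).
  split; first by exists (h 0), 0.
  by exists b => _ [t _ <-]; case/andP: (proj2 ph t).
set L := sup (range h).
have hL t : h t <= L by apply: ub_le_sup; [case: sh | exists t].
have Lb : L <= b.
  apply: ge_sup; first by case: sh.
  by move=> _ [t _ <-]; case/andP: (proj2 ph t).
have aL : a < L by exact: lt_le_trans at0 (hL _).
have GhL t : G (h t) <= L.
  apply: le_trans (hL (t - 1)); rewrite -(hE (t - 1)).
  by have /andP[+ _] := average_bounds (t - 1) ms ph; rewrite subrK.
have LE : L = b.
  apply/eqP; rewrite eq_le Lb leNgt; apply/negP => Lltb.
  have GL := ms_above ms aL Lltb.
  have aLb : a <= L <= b by lra.
  have : \forall y \near L, L < G y.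
    by have := cvgr_gt (G L) (ms_cont ms aLb); apply.
  move=> /nbhs_ballP[d /= d0 Hd].
  have [_ [t _ <-] tL] := sup_adherent d0 sh.
  have := Hd (h t); rewrite /ball /= ger0_norm ?subr_ge0 //.
  move=> /(_ ltac:(rewrite -/L in tL; lra)).
  by have := GhL t; lra.
apply/cvgrPdist_le => e e0.
have [_ [t1 _ <-] tL] := sup_adherent e0 sh.
rewrite -/L LE in tL.
near=> t.
have ht : h t1 <= h t.
  apply: (proj1 ph); near: t; apply: nbhs_ninfty_le; exact: num_real.
have /andP[_ hb] := proj2 ph t.
by rewrite ger0_norm; lra.
Unshelve. all: by end_near. Qed.

(** * From time to space *)

(** The lower bound on the increments makes z injective and, with the
    intermediate value theorem, onto. *)
Lemma exists_inverse_time (R : realType) (z dz : R -> R) (m : R) : 0 < m ->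
  (forall t : R, is_derive t 1 z (dz t)) -> (forall t, 0 < dz t) ->
  (forall s t, s <= t -> m * (t - s) <= z t - z s) ->
  exists tau : R -> R, [/\ cancel z tau, cancel tau z,
    forall x : R, is_derive x 1 tau (dz (tau x))^-1,
    tau x @[x --> -oo] --> -oo & tau x @[x --> +oo] --> +oo] /\
    {homo tau : x y / x <= y}.
Proof.
move=> m0 dzP dz0 zm.
have cz : continuous z.
  move=> t; apply/differentiable_continuous/derivable1_diffP.
  by case: (dzP t).
have surj x : {t | z t = x}.
  apply: cid; pose A := `|x - z 0| / m.
  have A0 : 0 <= A by rewrite divr_ge0 // ltW.
  have mA : m * A = `|x - z 0| by rewrite /A mulrC divfK // lt0r_neq0.
  have nA0 : - A <= 0 by lra.
  have := zm _ _ A0; have := zm _ _ nA0; rewrite subr0 sub0r opprK mA.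
  have := ler_norm (x - z 0); have := ler_norm (- (x - z 0)); rewrite normrN.
  move=> h1 h2 h3 h4.
  have [] := @IVT R z (- A) A x; first by lra.
  - exact: continuous_subspaceT.
  - by rewrite ge_min le_max; apply/andP; split; apply/orP; [left | right]; lra.
  by move=> t _ zt; exists t.
pose tau x := sval (surj x).
have tauK : cancel tau z by move=> x; exact: (svalP (surj x)).
have mono s t : z s <= z t -> s <= t.
  move=> zst; rewrite leNgt; apply/negP => ts.
  have := zm _ _ (ltW ts); have : 0 < m * (s - t) by rewrite mulr_gt0 ?subr_gt0.
  by lra.
have zK : cancel z tau.
  move=> t; apply/eqP; rewrite eq_le.
  by apply/andP; split; apply: mono; rewrite tauK.
exists tau; split; last by move=> x y xy; apply: mono; rewrite !tauK.
split => //.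
- move=> x; rewrite -{1}(tauK x); apply: is_derive_inverse => //.
  + by near=> y; exact: zK.
  + by near=> y; exact: cz.
  + by rewrite lt0r_neq0.
- apply/cvgrNyPle => A; near=> x; apply: mono; rewrite tauK.
  by near: x; apply: nbhs_ninfty_le; exact: num_real.
- apply/cvgryPge => A; near=> x; apply: mono; rewrite tauK.
  by near: x; apply: nbhs_pinfty_ge; exact: num_real.
Unshelve. all: by end_near. Qed.

(** With x = z(t), the relation z(t) + ell h(t) = z(t + 1) says that the point
    x + ell / W(x) is reached at time t + 1, so the delay equation is the chain
    rule applied to h' = G (h (t + 1)) - G (h t) and z' = ell G (h t). *)
Lemma profile_of_headway (R : realType) (ell c a b g C : R) (phi : R -> R) :
  0 < ell -> 0 < c -> 0 < a ->
  monostable (fun y => c * phi y^-1) a b g C ->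
  exists W : R -> R, [/\ forall x, b^-1 <= W x <= a^-1,
    {homo W : x y / x <= y},
    forall x, satisfies_dde_at ell phi W x,
    W x @[x --> -oo] --> b^-1 & W x @[x --> +oo] --> a^-1].
Proof.
move=> ell0 c0 a0 ms; have ab := ms_lt ms.
set G := fun y => c * phi y^-1 in ms *.
have [lam lam0 lamE] := decay_rate (ms_slope ms).
have [h [ph hE hsub hsup]] := exists_fixed_profile ms lam0 lamE.
have hab := proj2 ph; have Fni := profile_comp ms ph.
have cF := fixed_profile_speed_continuous ms ph hE.
have ha := fixed_profile_cvg_pinfty lam0 ph hsup.
have hb : h t @[t --> -oo] --> b.
  apply: (fixed_profile_cvg_ninfty ms ph hE).
  have [t at_] := subsolution_gt ab (ms_curv ms) lam0.
  by exists t; exact: lt_le_trans at_ (hsub t).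
have h0 t : 0 < h t by have /andP[ah _] := hab t; lra.
have G0 t : 0 < G (h t) by have /andP[aG _] := ms_range ms (hab t); lra.
pose z t := ell * primitive (G \o h) t.
have dz (t : R) : is_derive t 1 z (ell * G (h t)).
  have d := is_derive_primitive Fni (cF t).
  by have -> : z = ell *: primitive (G \o h) by []; exact: is_deriveZ.
have zm s t : s <= t -> ell * a * (t - s) <= z t - z s.
  move=> st; rewrite /z -mulrBr -mulrA ler_pM2l //.
  have /andP[+ _] := primitive_bounds Fni st; apply: le_trans.
  by rewrite ler_wpM2r ?subr_ge0 //; case/andP: (ms_range ms (hab t)).
have dz0 t : 0 < ell * G (h t) by rewrite mulr_gt0.
have [tau [[zK tauK dtau tauNy tauy] tau_homo]] :=
  exists_inverse_time (mulr_gt0 ell0 a0) dz dz0 zm.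
have zS t : z t + ell * h t = z (t + 1).
  by rewrite -(hE t) (average_primitive _ ms ph) /z; ring.
exists (fun x => (h (tau x))^-1); split.
- move=> x; have /andP[ah hb'] := hab (tau x).
  by rewrite !lef_pV2 ?posrE ?ah ?hb' //; lra.
- move=> x y xy; rewrite lef_pV2 ?posrE //.
  by apply: (proj1 ph); exact: tau_homo.
- move=> x; have phiE t : phi (h t)^-1 = G (h t) / c.
    by rewrite /G mulrC mulKf // lt0r_neq0.
  split; first by rewrite phiE mulf_neq0 ?invr_neq0 // lt0r_neq0.
  have -> : W_ahead ell (fun x => (h (tau x))^-1) x = (h (tau x + 1))^-1.
    rewrite /W_ahead invr_eq0 gt_eqF //= invrK.
    by rewrite -{1}(tauK x) zS zK.
  have hn0 : h (tau x) != 0 by rewrite lt0r_neq0.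
  have dh := is_derive_fixed_profile (tau x) ms ph hE.
  have dht := is_derive1_comp dh (dtau x).
  apply: (is_derive_eq (is_deriveV _ dht)) => //.
  rewrite !phiE /GRing.scale /=.
  have gn0 : G (h (tau x)) != 0 by rewrite lt0r_neq0.
  have cn0 : c != 0 by rewrite lt0r_neq0.
  have en0 : ell != 0 by rewrite lt0r_neq0.
  by field; rewrite hn0 gn0 cn0 en0.
- apply: cvgV; first by lra.
  by apply: cvg_comp tauNy _; exact: hb.
- apply: cvgV; first by lra.
  by apply: cvg_comp tauy _; exact: ha.
Qed.

(** * One-sided derivatives and the fundamental diagram *)

Lemma has_derivative_on_interior (R : realType) (I : set R) (f df : R -> R) :
  has_derivative_on I f df -> forall x, nbhs x I -> is_derive x 1 f (df x).
Proof.
move=> fdf x nI; have Ix : I x by exact: nbhs_singleton.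
apply: is_derive_difference_quotient.
apply: cvg_trans (fdf x Ix); apply: cvg_fmap2 => A.
rewrite /within /= => wA.
have nI' : \forall y \near x^', I y by exact: nbhs_dnbhs.
by near=> y; apply: (near wA y) => //; near: y.
Unshelve. all: by end_near. Qed.

(** At an endpoint of I the continuity is one-sided, which is what the mean value
    theorem needs on subintervals reaching 0 or 1. *)
Lemma has_derivative_on_continuous (R : realType) (I : set R) (f df : R -> R) :
  has_derivative_on I f df -> {within I, continuous f}.
Proof.
move=> fdf; apply/subspace_continuousP => x Ix.
have fl := fdf x Ix; apply/cvgrPdist_le => e e0.
have K0 : 0 < `|df x| + 1 by have := normr_ge0 (df x); lra.
have lip : \forall y \near x, I y -> y != x ->
    `|(f y - f x) / (y - x)| <= `|df x| + 1.
  have near1 : \forall y \near x, y != x -> I y ->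
      `|df x - (f y - f x) / (y - x)| <= 1.
    by have /cvgrPdist_le /(_ 1 ltr01) := fl.
  apply: filterS near1 => y dq Iy yx; have {dq} := dq yx Iy.
  rewrite distrC => d1; rewrite -[X in `|X|](subrK (df x)) addrC.
  by apply: (le_trans (ler_normD _ _)); rewrite lerD2l.
suff : \forall y \near x, I y -> `|f x - f y| <= e by [].
have near2 : \forall y \near x, `|x - y| < e / (`|df x| + 1).
  by apply/nbhs_ballP; exists (e / (`|df x| + 1)) => //=; exact: divr_gt0.
near=> y => Iy.
have [->|yx] := eqVneq y x; first by rewrite subrr normr0 ltW.
have : `|(f y - f x) / (y - x)| <= `|df x| + 1 by apply: (near lip y).
have yx0 : y - x != 0 by rewrite subr_eq0.
rewrite normrM normrV ?unitfE // ler_pdivrMr ?normr_gt0 //.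
rewrite distrC => /le_trans; apply.
rewrite mulrC -ler_pdivlMr // distrC ltW //.
by apply: (near near2 y).
Unshelve. all: by end_near. Qed.

Lemma nbhs_itv01 (R : realType) (x : R) :
  0 < x < 1 -> nbhs x (`[0, 1]%classic : set R).
Proof.
move=> x01; have : x \in `]0, 1[ by rewrite in_itv.
by move/near_in_itvoo; apply: filterS => y /=; rewrite !in_itv /=; lra.
Qed.

Lemma has_derivative_on_mvt (R : realType) (f df : R -> R) (s t : R) :
  has_derivative_on `[0, 1] f df -> 0 <= s -> s < t -> t <= 1 ->
  exists2 x, s < x < t & f t - f s = df x * (t - s).
Proof.
move=> fdf s0 st t1.
have cf : {within `[s, t], continuous f}.
  apply: continuous_subspaceW (has_derivative_on_continuous fdf).
  by move=> x /=; rewrite !in_itv /=; lra.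
have dfi x : x \in `]s, t[ -> is_derive x 1 f (df x).
  rewrite in_itv /= => xst; apply: (has_derivative_on_interior fdf).
  by apply: nbhs_itv01; lra.
by have [x + e] := MVT st dfi cf; rewrite in_itv /= => xst; exists x.
Qed.

Lemma has_derivative_on_decreasing (R : realType) (f df : R -> R) (c s t : R) :
  has_derivative_on `[0, 1] f df -> 0 < c ->
  (forall x, 0 <= x <= 1 -> df x <= - c) ->
  0 <= s -> s < t -> t <= 1 -> f t < f s.
Proof.
move=> fdf c0 dfc s0 st t1.
have [x xst e] := has_derivative_on_mvt fdf s0 st t1.
have dx := dfc x ltac:(lra).
have : df x * (t - s) < 0 by rewrite pmulr_llt0; lra.
by lra.
Qed.

Lemma concave_increasing (R : realType) (f df : R -> R) (top s t : R) :
  has_derivative_on `[0, 1] f df ->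
  (forall s t, 0 <= s -> s < t -> t <= 1 -> df t < df s) ->
  df top = 0 -> top <= 1 -> 0 <= s -> s < t -> t <= top -> f s < f t.
Proof.
move=> fdf df_dec dftop top1 s0 st ttop; rewrite -subr_gt0.
have t1 : t <= 1 by lra.
have [y y1 ->] := has_derivative_on_mvt fdf s0 st t1.
by rewrite mulr_gt0 ?subr_gt0 // -dftop; apply: df_dec; lra.
Qed.

Lemma concave_decreasing (R : realType) (f df : R -> R) (top s t : R) :
  has_derivative_on `[0, 1] f df ->
  (forall s t, 0 <= s -> s < t -> t <= 1 -> df t < df s) ->
  df top = 0 -> 0 <= top -> top <= s -> s < t -> t <= 1 -> f t < f s.
Proof.
move=> fdf df_dec dftop top0 tops st t1; rewrite -subr_lt0.
have s0 : 0 <= s by lra.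
have [y y1 ->] := has_derivative_on_mvt fdf s0 st t1.
by rewrite pmulr_llt0 ?subr_gt0 // -dftop; apply: df_dec; lra.
Qed.

Lemma concave_le_tangent (R : realType) (f df : R -> R) (s t : R) :
  has_derivative_on `[0, 1] f df ->
  (forall s t, 0 <= s -> s < t -> t <= 1 -> df t < df s) ->
  0 <= s -> s <= t -> t <= 1 -> f s <= f t + df t * (s - t).
Proof.
move=> fdf df_dec s0 + t1; rewrite le_eqVlt => /predU1P[->|st].
  by rewrite subrr mulr0 addr0.
have [y /andP[sy yt] e] := has_derivative_on_mvt fdf s0 st t1.
have dy : df t < df y by apply: df_dec => //; lra.
have : 0 <= (df y - df t) * (t - s) by apply: mulr_ge0; lra.
by lra.
Qed.

(** Two mean value theorems instead of a Taylor formula, hence D and not D/2. *)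
Lemma second_order_lower_bound (R : realType) (f df d2f : R -> R) (D s t : R) :
  has_derivative_on `[0, 1] f df -> has_derivative_on `[0, 1] df d2f ->
  0 <= D -> (forall x, 0 <= x <= 1 -> - D <= d2f x) ->
  0 <= s -> s <= t -> t <= 1 ->
  f t + df t * (s - t) - D * (s - t) ^+ 2 <= f s.
Proof.
move=> fdf dfd D0 HD s0 + t1; rewrite le_eqVlt => /predU1P[->|st].
  by rewrite subrr expr0n /= !mulr0 addr0 subr0.
have [y /andP[sy yt] e] := has_derivative_on_mvt fdf s0 st t1.
have y0 : 0 <= y by lra.
have [u u1 e'] := has_derivative_on_mvt dfd y0 yt t1.
have Du : - D <= d2f u by apply: HD; lra.
have h1 : 0 <= (d2f u + D) * (t - y) by apply: mulr_ge0; lra.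
have h2 : 0 <= D * (y - s) by apply: mulr_ge0; lra.
have : 0 <= (df t + D * (t - s) - df y) * (t - s) by apply: mulr_ge0; lra.
by lra.
Qed.

(** Here c = 1 / (rhop phi(rhop)), so that c/V times the flux is 1 at both states,
    and c phi(1/y) = (c/V) y f(1/y).  The tangent line of f at rhop turns into the
    tangent of y |-> c phi(1/y) at 1/rhop, whose slope is
    1 - (c/V) f'(rhop) rhop > 1; a second-order lower bound of phi at rhop gives
    the parabola. *)
Lemma fundamental_diagram_monostable (R : realType) (V : R)
  (phi dphi d2phi df d2f : R -> R) (hc0 c0 rhostar rhom rhop : R) :
  0 < V ->
  has_derivative_on `[0, 1] phi dphi ->
  has_derivative_on `[0, 1] dphi d2phi ->
  {within `[0, 1], continuous d2phi} ->
  phi 1 = 0 -> 0 < hc0 ->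
  (forall rho, 0 <= rho <= 1 -> dphi rho <= - hc0) ->
  has_derivative_on `[0, 1] (flux V phi) df ->
  has_derivative_on `[0, 1] df d2f ->
  0 < c0 -> (forall rho, 0 <= rho <= 1 -> d2f rho <= - c0) ->
  df rhostar = 0 -> 0 < rhom -> rhom < rhostar -> rhostar < rhop -> rhop < 1 ->
  flux V phi rhom = flux V phi rhop ->
  exists c g C : R, 0 < c /\
    monostable (fun y => c * phi y^-1) rhop^-1 rhom^-1 g C.
Proof.
move=> V0 dphiP d2phiP d2phi_cont phi1 hc0_gt0 dphi_le dfP d2fP c0_gt0 d2f_le
  dfstar rhom0 rhomstar starrhop rhop1 flux_eq.
have phi_dec s t := @has_derivative_on_decreasing R phi dphi hc0 s t
  dphiP hc0_gt0 dphi_le.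
have df_dec s t := @has_derivative_on_decreasing R df d2f c0 s t
  d2fP c0_gt0 d2f_le.
have phip0 : 0 < phi rhop by rewrite -phi1; apply: phi_dec; lra.
pose c := (rhop * phi rhop)^-1.
have cpos : 0 < c by rewrite invr_gt0 mulr_gt0 //; lra.
have cp : c * (rhop * phi rhop) = 1 by rewrite mulVf // mulf_neq0 //; lra.
have cm : c * (rhom * phi rhom) = 1.
  rewrite -cp; congr (_ * _); move: flux_eq; rewrite /flux -!mulrA.
  by apply: mulfI; rewrite lt0r_neq0.
have dfp : df rhop = V * (phi rhop + rhop * dphi rhop).
  have rp01 : 0 < rhop < 1 by lra.
  have d1 := has_derivative_on_interior dphiP (nbhs_itv01 rp01).
  have [_ <-] := has_derivative_on_interior dfP (nbhs_itv01 rp01).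
  have -> : flux V phi = V *: ((id : R -> R) * phi).
    by apply/funext => x; rewrite /flux -mulrA.
  by rewrite derive_val /GRing.scale /= mulr1; ring.
have dfp0 : df rhop < 0 by rewrite -dfstar; apply: df_dec; lra.
have [D D0 HD] : exists2 D : R, 0 <= D &
    forall x, 0 <= x <= 1 -> - D <= d2phi x.
  have [m _ Hm] := EVT_min ler01 d2phi_cont.
  exists `|d2phi m| => // x x01; have := Hm x; rewrite in_itv => /(_ x01).
  by have := ler_norm (- d2phi m); rewrite normrN; lra.
have flux_gt x : rhom < x -> x < rhop -> flux V phi rhop < flux V phi x.
  move=> mx xp; have [xs|xs] := leP x rhostar.
    by rewrite -flux_eq; apply: (concave_increasing dfP df_dec dfstar); lra.
  by apply: (concave_decreasing dfP df_dec dfstar); lra.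
have tangent x : rhom <= x -> x <= rhop ->
    flux V phi x <= flux V phi rhop + df rhop * (x - rhop).
  move=> mx xp; apply: (concave_le_tangent dfP df_dec) => //; last exact: ltW.
  exact: le_trans (ltW rhom0) mx.
have parabola x : rhom <= x -> x <= rhop ->
    phi rhop + dphi rhop * (x - rhop) - D * (x - rhop) ^+ 2 <= phi x.
  move=> mx xp; apply: (second_order_lower_bound dphiP d2phiP D0 HD) => //.
    exact: le_trans (ltW rhom0) mx.
  exact: ltW.
have dphip : dphi rhop < 0.
  by have := dphi_le rhop ltac:(lra); lra.
have rp0 : 0 < rhop by lra.
have mp_ge0 : 0 <= rhom^-1 * - dphi rhop + D.
  apply: addr_ge0 => //; apply: mulr_ge0; first by rewrite invr_ge0 ltW.
  by lra.
have inv_mp : rhop^-1 < rhom^-1 by rewrite ltf_pV2 ?posrE //; lra.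
clear dphi_le d2f_le d2phi_cont c0_gt0 hc0_gt0 D0 HD phip0 dfstar.
pose g := 1 - c / V * df rhop * rhop.
pose C := c * (rhom^-1 * - dphi rhop + D) * rhop ^+ 4.
exists c, g, C; split => //.
have Vn0 : V != 0 by rewrite lt0r_neq0.
have pn0 : rhop != 0 by rewrite lt0r_neq0.
have mn0 : rhom != 0 by rewrite lt0r_neq0.
have inv_itv y : rhop^-1 <= y <= rhom^-1 -> rhom <= y^-1 <= rhop.
  move=> /andP[py ym]; have y0 : 0 < y by rewrite (lt_le_trans _ py) ?invr_gt0.
  by rewrite -[rhom]invrK -[rhop]invrK !lef_pV2 ?posrE ?invr_gt0 ?py ?ym.
have itv_gt0 y : rhop^-1 <= y -> 0 < y.
  by move=> py; rewrite (lt_le_trans _ py) ?invr_gt0.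
have GE y : 0 < y -> c * phi y^-1 = c / V * y * flux V phi y^-1.
  by move=> y0; rewrite /flux; field; rewrite Vn0 lt0r_neq0.
have cn0 : c != 0 by rewrite lt0r_neq0.
have fluxp : flux V phi rhop = V / c.
  by apply: (mulfI cn0); rewrite /flux -!mulrA mulrCA cp; field.
have cV0 : 0 < c / V by rewrite divr_gt0.
split.
- exact: inv_mp.
- rewrite /g -subr_gt0 addrAC subrr add0r oppr_gt0 pmulr_llt0 //.
  by rewrite pmulr_rlt0.
- rewrite /C; apply: mulr_ge0; last by rewrite exprn_ge0 // ltW.
  by apply: mulr_ge0 => //; exact: ltW.
- move=> x y px; rewrite le_eqVlt => /predU1P[->//|xy] ym.
  have /inv_itv xi : rhop^-1 <= x <= rhom^-1 by lra.
  have /inv_itv yi : rhop^-1 <= y <= rhom^-1 by lra.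
  rewrite ler_pM2l //; apply/ltW/phi_dec.
  + by apply: le_trans (ltW rhom0) _; case/andP: yi.
  + by rewrite ltf_pV2 ?posrE // itv_gt0 //; apply: le_trans px _; exact: ltW.
  + by apply: le_trans (ltW rhop1); case/andP: xi.
- by rewrite invrK; apply: (mulfI mn0); rewrite mulfV // mulrCA.
- move=> x px xm; have x0 : 0 < x by apply: itv_gt0; lra.
  have mx : rhom < x^-1 by rewrite -[rhom]invrK ltf_pV2 ?posrE ?invr_gt0.
  have xp : x^-1 < rhop by rewrite -[rhop]invrK ltf_pV2 ?posrE ?invr_gt0.
  have := flux_gt _ mx xp; rewrite fluxp GE // => lt.
  have e : x = c / V * x * (V / c) by field; rewrite cn0 Vn0.
  by rewrite {1}e ltr_pM2l // mulr_gt0.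
- move=> x /[dup] /inv_itv xi /andP[px _]; have x0 := itv_gt0 _ px.
  have x01 : 0 < x^-1 < 1 by lra.
  have [d _] := has_derivative_on_interior dphiP (nbhs_itv01 x01).
  apply: cvgM; first exact: cvg_cst.
  apply: (@continuous_comp _ _ _ (fun y : R => y^-1) phi).
    by apply: inv_continuous; rewrite lt0r_neq0.
  exact/differentiable_continuous/derivable1_diffP.
- move=> x /[dup] /inv_itv /andP[mx xp] /andP[px _]; have x0 := itv_gt0 _ px.
  have xn0 : x != 0 by rewrite lt0r_neq0.
  rewrite GE //; have cVx0 : 0 <= c / V * x by rewrite mulr_ge0 // ltW.
  apply: (le_trans (ler_wpM2l cVx0 (tangent _ mx xp))).
  rewrite le_eqVlt; apply/orP; left; apply/eqP.
  by rewrite fluxp /g; field; rewrite cn0 Vn0 xn0 pn0.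
- move=> x /[dup] /inv_itv /andP[mx xp] /andP[px xm]; have x0 := itv_gt0 _ px.
  have xn0 : x != 0 by rewrite lt0r_neq0.
  apply: (le_trans _ (ler_wpM2l (ltW cpos) (parabola _ mx xp))).
  have phip : phi rhop = (c * rhop)^-1.
    by apply: (mulfI (mulf_neq0 cn0 pn0)); rewrite mulfV ?mulf_neq0 // -mulrA.
  (* The bound is quadratic in 1/x - rhop = - rhop (x - 1/rhop) / x.  The tangent
     part leaves a term in c phi'(rhop) x, which C covers because x <= 1/rhom. *)
  set r2 := (x^-1 - rhop) ^+ 2.
  have d2 : (x - rhop^-1) ^+ 2 * rhop ^+ 4 = (x * rhop) ^+ 2 * r2.
    by rewrite /r2; field; rewrite xn0 pn0.
  have -> : rhop^-1 + g * (x - rhop^-1) =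
      c * (phi rhop + dphi rhop * (x^-1 - rhop)) - c * dphi rhop * x * r2.
    rewrite /r2 /g dfp phip; field.
    by rewrite cn0 Vn0 xn0 pn0.
  have -> : C * (x - rhop^-1) ^+ 2 =
      c * (rhom^-1 * - dphi rhop + D) * ((x - rhop^-1) ^+ 2 * rhop ^+ 4).
    by rewrite /C; ring.
  rewrite d2; have r20 : 0 <= r2 by exact: sqr_ge0.
  have xp1 : 1 <= (x * rhop) ^+ 2.
    rewrite expr_ge1 //; last by rewrite mulr_ge0 ?ltW.
    by rewrite -ler_pdivrMr // div1r.
  have s2 : r2 <= (x * rhop) ^+ 2 * r2 by rewrite ler_peMl.
  have h1 := ler_wpM2l (mulr_ge0 (ltW cpos) mp_ge0) s2.
  have h2 : 0 <= c * ((rhom^-1 - x) * - dphi rhop) * r2.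
    apply: mulr_ge0 => //; apply: mulr_ge0; first exact: ltW.
    by apply: mulr_ge0; lra.
  by lra.
Qed.

(** * Existence of the profile *)

Lemma step_profile (R : realType) (ell : R) (phi : R -> R) : phi 0 = 1 ->
  exists W : R -> R, [/\ forall x, 0 <= W x <= 1,
    {homo W : x y / x <= y}, stationary_profile ell phi 0 1 W,
    W x @[x --> -oo] --> (0 : R) & W x @[x --> +oo] --> (1 : R)].
Proof.
move=> phi0; pose W (x : R) : R := if x < 0 then 0 else 1; exists W; split.
- by move=> x; rewrite /W; case: ifP; rewrite lexx ler01.
- move=> x y xy; rewrite /W; case: (ltP x 0) => x0; case: (ltP y 0) => y0 //.
  by lra.
- rewrite /stationary_profile !eqxx /=; exists 0; split.
  + by move=> x x0; rewrite /W x0.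
  + by move=> x x0; rewrite /W ltNge (ltW x0).
  + move=> x x0; have Wx : W x = 0 by rewrite /W x0.
    split; first by rewrite Wx phi0 oner_neq0.
    rewrite Wx expr0n /= !mul0r; apply: is_derive_difference_quotient.
    apply: cvg_near_cst; rewrite near_withinE.
    near=> y => _; have y0 : y < 0 by near: y; exact: lt_nbhsl.
    by rewrite Wx /W y0 subrr mul0r.
- apply: cvg_near_cst; near=> x.
  have x0 : x < 0 by near: x; apply: nbhs_ninfty_lt; exact: num_real.
  by rewrite /W x0.
- apply: cvg_near_cst; near=> x.
  have x0 : 0 <= x by near: x; apply: nbhs_pinfty_ge; exact: num_real.
  by rewrite /W ltNge x0.
Unshelve. all: by end_near. Qed.

Lemma constant_profile (R : realType) (ell r : R) (phi : R -> R) :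
  0 < r < 1 -> phi r != 0 ->
  exists W : R -> R, [/\ forall x, 0 <= W x <= 1,
    {homo W : x y / x <= y}, stationary_profile ell phi r r W,
    W x @[x --> -oo] --> r & W x @[x --> +oo] --> r].
Proof.
move=> r01 phir; exists (cst r); split => //=; [by move=> x; lra|..].
- rewrite /stationary_profile; have /gt_eqF -> /= : 0 < r by lra.
  move=> x; split=> //=; rewrite /W_ahead /= gt_eqF ?subrr ?mulr0; last by lra.
  exact: is_derive_cst.
- exact: cvg_cst.
- exact: cvg_cst.
Qed.

Unset Implicit Arguments.
Set Strict Implicit.

Theorem theorem3p1 (R : realType) (ell V : R)
  (phi dphi d2phi df d2f : R -> R) (hc0 c0 rhostar rhom rhop : R)
  (ell_gt0 : 0 < ell) (V_gt0 : 0 < V)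
  (dphiP : has_derivative_on `[0, 1] phi dphi)
  (d2phiP : has_derivative_on `[0, 1] dphi d2phi)
  (d2phi_cont : {within `[0, 1], continuous d2phi})
  (phi0 : phi 0 = 1) (phi1 : phi 1 = 0)
  (hc0_gt0 : 0 < hc0)
  (dphi_le : forall rho, 0 <= rho <= 1 -> dphi rho <= - hc0)
  (dfP : has_derivative_on `[0, 1] (flux V phi) df)
  (d2fP : has_derivative_on `[0, 1] df d2f)
  (c0_gt0 : 0 < c0)
  (d2f_le : forall rho, 0 <= rho <= 1 -> d2f rho <= - c0)
  (rhostar_in : 0 < rhostar < 1)
  (df_rhostar : df rhostar = 0)
  (rhostar_uniq : forall rho, 0 <= rho <= 1 -> df rho = 0 -> rho = rhostar)
  (rhom_ge0 : 0 <= rhom) (rhom_le : rhom <= rhostar)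
  (rhop_ge : rhostar <= rhop) (rhop_le1 : rhop <= 1)
  (flux_eq : flux V phi rhom = flux V phi rhop) :
  exists W : R -> R,
    [/\ forall x, 0 <= W x <= 1,
        {homo W : x y / x <= y},
        stationary_profile ell phi rhom rhop W,
        W x @[x --> -oo] --> rhom &
        W x @[x --> +oo] --> rhop].
Proof.
have phi_dec s t := @has_derivative_on_decreasing R phi dphi hc0 s t
  dphiP hc0_gt0 dphi_le.
have df_dec s t := @has_derivative_on_decreasing R df d2f c0 s t
  d2fP c0_gt0 d2f_le.
have phi_gt0 r : 0 <= r -> r < 1 -> 0 < phi r.
  by move=> r0 r1; rewrite -phi1; exact: phi_dec.
have [star0 star1] := andP rhostar_in.
have [rhom0|rhomN0] := eqVneq rhom 0.
  have -> : rhop = 1.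
    apply/eqP; rewrite eq_le rhop_le1 leNgt; apply/negP => p1.
    have : 0 < flux V phi rhop.
      by rewrite /flux !mulr_gt0 ?phi_gt0 //; lra.
    by rewrite -flux_eq rhom0 /flux mulr0 mul0r ltxx.
  by rewrite rhom0; exact: step_profile.
have rhom_gt0 : 0 < rhom by rewrite lt_def rhomN0.
have fluxm : 0 < flux V phi rhom by rewrite /flux !mulr_gt0 ?phi_gt0 //; lra.
have rhop1 : rhop < 1.
  rewrite lt_neqAle rhop_le1 andbT; apply/eqP => p1.
  by move: fluxm; rewrite flux_eq p1 /flux phi1 mulr0 ltxx.
have [rhomE|rhomN] := eqVneq rhom rhostar.
  have -> : rhop = rhom.
    apply/eqP; rewrite eq_le rhomE rhop_ge andbT leNgt; apply/negP => sp.
    have := concave_decreasing dfP df_dec df_rhostar (ltW star0) (lexx _) sp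
      rhop_le1.
    by rewrite -flux_eq rhomE ltxx.
  by apply: constant_profile; rewrite ?lt0r_neq0 ?phi_gt0 //; lra.
have ms : rhom < rhostar by rewrite lt_neqAle rhomN.
have sp : rhostar < rhop.
  rewrite lt_neqAle rhop_ge andbT; apply/eqP => sp.
  have := concave_increasing dfP df_dec df_rhostar (ltW star1) rhom_ge0 ms
    (lexx _).
  by rewrite flux_eq -sp ltxx.
have [c [g [C [cpos mono]]]] := fundamental_diagram_monostable V_gt0 dphiP
  d2phiP d2phi_cont phi1 hc0_gt0 dphi_le dfP d2fP c0_gt0 d2f_le df_rhostar
  rhom_gt0 ms sp rhop1 flux_eq.
have rhop0 : 0 < rhop^-1 by rewrite invr_gt0; lra.
have [W [W01 Wmono Wdde Wm Wp]] := profile_of_headway ell_gt0 cpos rhop0 mono.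
rewrite !invrK in W01 Wm Wp.
exists W; split => //.
- by move=> x; have := W01 x; lra.
- by rewrite /stationary_profile (negbTE rhomN0).
Qed.
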